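(* Let $0\le a<b\le 1$ and let $B|_{[a,b]}$ be the Bernoulli channel with inputs restricted to $[a,b]$. Fix $L\in\mathbb N$, $L\ge1$, and put $\lambda^{(n)}=2\exp\left[-2(\log n)^2\right]$. Then there exists a sequence of $(n,N^{(n)},L\lambda^{(n)},\lambda^{(n)})$ deterministic identification codes for $B|_{[a,b]}$ (for all sufficiently large $n$) with $$\frac{\log N^{(n)}}{n\log n}\longrightarrow\frac12\qquad(n\to\infty),$$ i.e. achieving linearithmic rate $\dot R=\frac12$. Hence $\dot C_{\mathrm{DI}}(B|_{[a,b]})=\frac12$.
   Context: Logarithms $\log$ are to base 2; $\exp$ is the natural exponential. The restricted Bernoulli channel $B|_{[a,b]}$ has input alphabet $\mathcal X=[a,b]$ and output alphabet $\mathcal Y=\{0,1\}$, with $B(1|x)=x$ and $B(0|x)=1-x$. Channels are memoryless: on input $x^n=(x_1,\dots,x_n)\in\mathcal X^n$, the output $Y^n$ has independent coordinates with $Y_i\sim W(\cdot|x_i)$; the resulting law is denoted $W^n(\cdot|x^n)$. An $(n,N,\lambda_1,\lambda_2)$ deterministic identification (DI) code for a channel $W:\mathcal X\to\mathcal Y$ is a family $\{(u_i,\mathcal D_i): i\in[N]\}$ with $u_i\in\mathcal X^n$ and $\mathcal D_i\subset\mathcal Y^n$ (regions may overlap) such that for all distinct $i,j\in[N]$: $W^n(\mathcal D_i|u_i)\ge 1-\lambda_1$ and $W^n(\mathcal D_j|u_i)\le\lambda_2$. A number $\dot R>0$ is an achievable linearithmic rate for $W$ if there is a sequence of $(n,N^{(n)},\lambda_1^{(n)},\lambda_2^{(n)})$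 DI codes with $\lambda_1^{(n)},\lambda_2^{(n)}\to0$ and $\frac{\log N^{(n)}}{n\log n}\to\dot R$ as $n\to\infty$. The linearithmic DI capacity $\dot C_{\mathrm{DI}}(W)$ is the largest achievable linearithmic rate. *)

(* Defs.v *)
(* MathComp-Analysis: the reals are an arbitrary [R : realType]. *)
From mathcomp Require Export all_boot all_order all_algebra.
From mathcomp Require Export all_classical all_reals all_analysis.

Set Implicit Arguments.
Unset Strict Implicit.
Unset Printing Implicit Defensive.

Import Order.TTheory GRing.Theory Num.Theory.
Import numFieldTopology.Exports numFieldNormedType.Exports.

Local Open Scope classical_set_scope.
Local Open Scope ring_scope.

Definition log2 (R : realType) (x : R) : R := ln x / ln 2.

Record channel (R : realType) (X : Type) (Y : finType) := Channel {
  transition :> X -> Y -> R;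
  transition_ge0 : forall x y, 0 <= transition x y;
  transition_sum1 : forall x, \sum_(y : Y) transition x y = 1
}.

(* [memoryless W x D] is W^n(D | x^n), the probability that the output word
   falls in [D]. *)
Definition memoryless (R : realType) (X : Type) (Y : finType)
    (W : channel R X Y) (n : nat) (x : {ffun 'I_n -> X})
    (D : {set {ffun 'I_n -> Y}}) : R :=
  \sum_(y in D) \prod_(i < n) W (x i) (y i).

Definition is_DI_code (R : realType) (X : Type) (Y : finType)
    (W : channel R X Y) (n N : nat) (lambda1 lambda2 : R)
    (u : 'I_N -> {ffun 'I_n -> X}) (D : 'I_N -> {set {ffun 'I_n -> Y}})
    : Prop :=
  forall i j : 'I_N, i != j ->
    1 - lambda1 <= memoryless W (u i) (D i) /\
    memoryless W (u i) (D j) <= lambda2.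

(* The values at n = 0 and n = 1, where the denominator vanishes, are
   irrelevant: only the limit of this sequence is used. *)
Definition linearithmic_ratio (R : realType) (N : nat -> nat) (n : nat) : R :=
  log2 (N n)%:R / (n%:R * log2 n%:R).

Definition achievable_linearithmic_rate (R : realType) (X : Type) (Y : finType)
    (W : channel R X Y) (rate : R) : Prop :=
  0 < rate /\
  exists (N : nat -> nat) (lambda1 lambda2 : nat -> R)
      (u : forall n, 'I_(N n) -> {ffun 'I_n -> X})
      (D : forall n, 'I_(N n) -> {set {ffun 'I_n -> Y}}),
    [/\ forall n, (0 < n)%N ->
          is_DI_code W (lambda1 n) (lambda2 n) (u n) (D n),
        lambda1 @ \oo --> (0 : R),
        lambda2 @ \oo --> (0 : R) &
        linearithmic_ratio R N @ \oo --> rate].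

Definition is_linearithmic_DI_capacity (R : realType) (X : Type) (Y : finType)
    (W : channel R X Y) (C : R) : Prop :=
  achievable_linearithmic_rate W C /\
  forall rate, achievable_linearithmic_rate W rate -> rate <= C.

Section RestrictedBernoulli.
Variables (R : realType) (a b : R) (a_ge0 : 0 <= a) (b_le1 : b <= 1).

Definition bernoulli_input : Type := {x : R | a <= x <= b}.

(* The output letter 1 is [true], and 0 is [false]. *)
Definition bernoulli_transition (x : bernoulli_input) (y : bool) : R :=
  bernoulli_pmf (sval x) y.

Lemma bernoulli_transition_ge0 x y : 0 <= bernoulli_transition x y.
Proof.
apply: bernoulli_pmf_ge0; case: x => x /= /andP[ax xb].
by rewrite (le_trans a_ge0 ax) (le_trans xb b_le1).
Qed.

Lemma bernoulli_transition_sum1 x :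
  \sum_(y : bool) bernoulli_transition x y = 1.
Proof. by rewrite big_bool /bernoulli_transition /bernoulli_pmf /= addrC subrK. Qed.

Definition restricted_bernoulli : channel R bernoulli_input bool :=
  Channel bernoulli_transition_ge0 bernoulli_transition_sum1.

End RestrictedBernoulli.

Arguments restricted_bernoulli {R a b} a_ge0 b_le1.

(* Main.v *)
(* Achievability.  For unit weights [w] the statistic [sum w_k (Y_k - v_k)] has subgaussian
   fluctuations of order 1, so the decoder of [v] can reject [u] by a linear test as soon as
   [<v - u, w>] is of order [log n].  If all codewords lie on a sphere around [c], the test
   [w = (v - c) / |v - c|] has [<v - u, w> = |v - u|^2 / (2 |v - c|)], so a sphere of radius [r]
   can be filled at distance about [sqrt (r log n)].  Each point is then replaced by a
   smaller copy of the construction, and points sharing the same coarse digits are told apart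
   by the tests of the smaller copy.  With [L] levels of [q ~ n^(1/(2L+3))]-ary digits, where
   every level is a Gilbert-Varshamov code of distance [n / (L+1)] and the sphere comes from the
   pigeonhole principle, the rate is [L^2 / ((L+1)(2L+3))], which tends to 1/2 with [L].

   Converse.  Quantizing [sqrt x - sqrt (1 - x)] to precision [1 / sqrt n] in each coordinate
   leaves at most [(5 sqrt n)^n] cells, and two words in the same cell have Bhattacharyya
   coefficient at least 1/2, so that no decoder can separate them.

   Since code sizes are bounded, the code of maximal size for each [n] beats the
   [L]-level codes for all [L] simultaneously, so no diagonal sequence has to be built. *)
Require Import Defs.
From mathcomp Require Import ring lra zify.

Set Implicit Arguments.
Unset Strict Implicit.
Unset Printing Implicit Defensive.

Import Order.TTheory GRing.Theory Num.Theory.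
Import numFieldTopology.Exports numFieldNormedType.Exports.

Local Open Scope classical_set_scope.
Local Open Scope ring_scope.

(** * Product channels and a Chernoff bound *)

Section ProductChannel.
Variable R : realType.

(** Inverting [1 - y <= expR (- y)] leaves [(1 + y + 2 y^2) (1 - y) = 1 + y^2 (1 - 2 y) >= 1]. *)
Lemma expR_le_quadratic (y : R) : y <= 1 / 2 -> expR y <= 1 + y + 2 * y ^+ 2.
Proof.
move=> y_le; have y_lt1 : 0 < 1 - y by lra.
have : expR (- y) >= 1 - y by rewrite expR_ge1Dx.
rewrite expRN -[X in X <= _]invrK lef_pV2 ?posrE ?invr_gt0 ?expR_gt0 // => h.
apply: (le_trans h).
rewrite -(ler_pM2r y_lt1) mulVf ?gt_eqF //.
nra.
Qed.

(** The letter is centered at its mean, so averaging the quadratic bound cancels the linear term. *)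
Lemma bernoulli_mgf_le (p z : R) : 0 <= p <= 1 -> `|z| <= 1 / 2 ->
  \sum_(y : bool) bernoulli_pmf p y * expR (z * (y%:R - p)) <= expR (2 * z ^+ 2).
Proof.
move=> /andP[p0 p1]; rewrite ler_norml => /andP[z0 z1].
rewrite big_bool /bernoulli_pmf /=.
have h1 : expR (z * (1 - p)) <= 1 + z * (1 - p) + 2 * (z * (1 - p)) ^+ 2.
  by apply: expR_le_quadratic; nra.
have h0 : expR (z * (0 - p)) <= 1 + z * (0 - p) + 2 * (z * (0 - p)) ^+ 2.
  by apply: expR_le_quadratic; nra.
apply: (@le_trans _ _ (1 + 2 * z ^+ 2)); last exact: expR_ge1Dx.
have p0' : 0 <= 1 - p by lra.
move: (ler_wpM2l p0 h1) (ler_wpM2l p0' h0) => {}h1 {}h0.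
apply: (le_trans (lerD h1 h0)).
have : 0 <= (1 - p * (1 - p)) * z ^+ 2 by apply: mulr_ge0; [nra|exact: sqr_ge0].
nra.
Qed.

Variables (X : Type) (Y : finType) (W : channel R X Y) (n : nat).
Implicit Types (x : {ffun 'I_n -> X}) (y : {ffun 'I_n -> Y}).

Definition word_prob x y : R := \prod_(i < n) W (x i) (y i).

Lemma word_prob_ge0 x y : 0 <= word_prob x y.
Proof. by apply: prodr_ge0 => i _; exact: transition_ge0. Qed.

Lemma sum_word_prob_prod x (g : 'I_n -> Y -> R) :
  \sum_(y : {ffun 'I_n -> Y}) word_prob x y * \prod_(i < n) g i (y i) =
  \prod_(i < n) \sum_(c : Y) W (x i) c * g i c.
Proof.
rewrite bigA_distr_bigA /=; apply: eq_bigr => y _.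
by rewrite /word_prob big_split.
Qed.

Lemma sum_word_prob x : \sum_(y : {ffun 'I_n -> Y}) word_prob x y = 1.
Proof.
have -> : 1 = \prod_(i < n) (1 : R) by rewrite big1_eq.
under [RHS]eq_bigr => i _ do rewrite -(transition_sum1 W (x i)).
by rewrite bigA_distr_bigA.
Qed.

Lemma memoryless_setC x (D : {set {ffun 'I_n -> Y}}) :
  memoryless W x (~: D)%SET = 1 - memoryless W x D.
Proof.
apply/eqP; rewrite eq_sym subr_eq -(sum_word_prob x); apply/eqP.
rewrite (bigID (mem D)) /= addrC; congr (_ + _).
by apply: eq_bigl => y; rewrite inE.
Qed.

Lemma memoryless_subset x (D E : {set {ffun 'I_n -> Y}}) :
  (D \subset E)%SET -> memoryless W x D <= memoryless W x E.
Proof.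
move=> DE; rewrite /memoryless big_mkcond [leRHS]big_mkcond /=.
apply: ler_sum => y _; case: ifPn => [yD|_]; first by rewrite (fintype.subsetP DE).
by case: ifP => // _; exact: word_prob_ge0.
Qed.

Lemma memoryless_bigcup_le x (I : finType) (E : I -> {set {ffun 'I_n -> Y}}) (e : R) :
  (forall i, memoryless W x (E i) <= e) ->
  memoryless W x (\bigcup_i E i)%SET <= #|I|%:R * e.
Proof.
move=> Ee; apply: (@le_trans _ _ (\sum_i memoryless W x (E i))); last first.
  by rewrite -sum1_card natr_sum mulr_suml; apply: ler_sum => i _; rewrite mul1r.
have -> : \sum_i memoryless W x (E i) =
    \sum_i \sum_y (if y \in E i then word_prob x y else 0).
  by apply: eq_bigr => i _; rewrite /memoryless big_mkcond.
rewrite exchange_big /= /memoryless big_mkcond; apply: ler_sum => y _.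
have ge0 i : 0 <= (if y \in E i then word_prob x y else 0).
  by case: ifP => // _; exact: word_prob_ge0.
case: ifPn => [/bigcupP[i _ yE]|_]; last exact: sumr_ge0.
by rewrite (bigD1 i) //= yE lerDl; exact: sumr_ge0.
Qed.

End ProductChannel.

Section BernoulliTail.
Variables (R : realType) (a b : R) (a_ge0 : 0 <= a) (b_le1 : b <= 1).
Let B := restricted_bernoulli a_ge0 b_le1.

Lemma bernoulli_tail n (x : {ffun 'I_n -> bernoulli_input a b})
    (w : 'I_n -> R) (t : R) :
  (0 < n)%N -> (forall k, `|w k| <= 1) -> 0 <= t <= 2 * Num.sqrt n%:R ->
  memoryless B x
    [set y : {ffun 'I_n -> bool} |
      t * Num.sqrt n%:R <= \sum_k w k * ((y k)%:R - sval (x k))]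
  <= expR (- (t ^+ 2 / 8)).
Proof.
move=> n_gt0 w_le1 /andP[t_ge0 t_le].
have rn_gt0 : 0 < Num.sqrt n%:R :> R by rewrite sqrtr_gt0 ltr0n.
set rn := Num.sqrt n%:R in rn_gt0 t_le *.
have rn2 : rn ^+ 2 = n%:R by rewrite sqr_sqrtr.
(* The minimizer of the Chernoff exponent [2 n s^2 - s t sqrt n], with value [- t^2 / 8]; the upper
   bound on [t] keeps [s <= 1 / 2]. *)
pose s := t / (4 * rn).
have s_ge0 : 0 <= s by rewrite divr_ge0 ?mulr_ge0 ?(ltW rn_gt0).
have s_le : s <= 1 / 2 by rewrite ler_pdivrMr ?mulr_gt0 //; lra.
pose T (y : {ffun 'I_n -> bool}) := \sum_k w k * ((y k)%:R - sval (x k)).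
apply: (@le_trans _ _ (\sum_y word_prob B x y * expR (s * (T y - t * rn)))).
  rewrite /memoryless big_mkcond /=; apply: ler_sum => y _; rewrite inE.
  have := word_prob_ge0 B x y; rewrite /word_prob => p_ge0.
  case: ifPn => [Ty|_]; last by rewrite mulr_ge0 ?expR_ge0.
  by rewrite ler_peMr // -expR0 ler_expR mulr_ge0 // subr_ge0.
under eq_bigr => y _.
  rewrite mulrBr expRD mulrA /T mulr_sumr expR_sum.
  over.
rewrite -mulr_suml.
rewrite (sum_word_prob_prod B x (fun k c => expR (s * (w k * (c%:R - sval (x k)))))).
have letter k : \sum_c B (x k) c * expR (s * (w k * (c%:R - sval (x k)))) <= expR (2 * s ^+ 2).
  under eq_bigr do rewrite mulrA.
  apply: (@le_trans _ _ (expR (2 * (s * w k) ^+ 2))).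
    apply: bernoulli_mgf_le.
      case: (x k) => z /= /andP[az zb].
      by rewrite (le_trans a_ge0 az) (le_trans zb b_le1).
    rewrite normrM (ger0_norm s_ge0) -[leRHS]mulr1.
    by apply: ler_pM.
  rewrite ler_expR ler_pM2l // exprMn ler_piMr ?sqr_ge0 //.
  by rewrite -real_normK ?num_real // exprn_ile1.
apply: (@le_trans _ _ (\prod_(k < n) expR (2 * s ^+ 2) * expR (- (s * (t * rn))))).
  apply: ler_wpM2r; first exact: expR_ge0.
  apply: ler_prod => k _; rewrite letter andbT.
  by apply: sumr_ge0 => c _; rewrite mulr_ge0 ?expR_ge0 ?transition_ge0.
rewrite prodr_const card_ord -expRM_natl -expRD ler_expR.
rewrite -rn2 /s le_eqVlt; apply/orP; left; apply/eqP; field.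
by rewrite gt_eqF.
Qed.
End BernoulliTail.

(** * Galaxy codes *)

Lemma card_bigcup_le (T I : finType) (P : pred I) (F : I -> {set T}) :
  (#|\bigcup_(i | P i) F i|%SET <= \sum_(i | P i) #|F i|)%N.
Proof.
elim/big_rec2: _ => [|i k A _ Ak]; first by rewrite cards0.
by rewrite (leq_trans (leq_card_setU _ _).1) // leq_add2l.
Qed.

Section Hamming.
Variables (n B : nat).
Implicit Types (x y : {ffun 'I_n -> 'I_B}) (C : {set {ffun 'I_n -> 'I_B}}).
Local Open Scope nat_scope.

Definition diff_set x y : {set 'I_n} := [set k | x k != y k]%SET.
Definition hamming x y : nat := #|diff_set x y|.

Lemma hammingC x y : hamming x y = hamming y x.
Proof. by congr #|pred_of_set _|; apply/setP => k; rewrite !inE eq_sym. Qed.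

Definition min_distance d C : bool :=
  [forall x in C, [forall y in C, (x != y) ==> (d <= hamming x y)]].

(** A word of the ball is determined by its difference set [S] from [x], one of at most [2 ^ n], and
    by its letters on [S]. *)
Lemma hamming_ball_card d x : 0 < B ->
  #|[set y | hamming x y < d]%SET| <= 2 ^ n * B ^ d.
Proof.
move=> B_gt0.
pose F (S : {set 'I_n}) (k : 'I_n) : pred 'I_B := if k \in S then predT else pred1 (x k).
have sub : ([set y | hamming x y < d] \subset
    \bigcup_(S : {set 'I_n} | #|S| <= d) [set y in family (F S)])%SET.
  apply/fintype.subsetP => y; rewrite inE => xy; apply/bigcupP.
  exists (diff_set x y); first exact: ltnW.
  rewrite inE; apply/familyP => k; rewrite /F inE.
  by case: ifPn => //; rewrite negbK => /eqP ->; rewrite inE.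
apply: (leq_trans (subset_leq_card sub)); apply: (leq_trans (card_bigcup_le _ _)).
apply: (@leq_trans (\sum_(S : {set 'I_n} | #|S| <= d) B ^ d)).
  apply: leq_sum => S Sd; rewrite cardsE card_family foldrE big_map big_enum /=.
  rewrite (bigID (mem S)) /= [X in _ * X]big1 ?muln1; last first.
    by move=> k kS; rewrite /F (negPf kS) card1.
  rewrite (eq_bigr (fun _ => B)); last by move=> k kS; rewrite /F kS card_ord.
  by rewrite prod_nat_const leq_pexp2l.
rewrite sum_nat_const leq_mul2r; apply/orP; right.
apply: (leq_trans (max_card _)); rewrite -cardsT -powersetT card_powerset.
by rewrite cardsT card_ord.
Qed.

(* A code of maximal cardinality has a covering radius below its minimum distance. *)
Lemma gilbert_varshamov d : 0 < B -> 0 < d ->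
  exists C, min_distance d C /\ B ^ n <= #|C| * (2 ^ n * B ^ d).
Proof.
move=> B_gt0 d_gt0.
have md0 : min_distance d finset.set0 by apply/forall_inP => x; rewrite inE.
case: (@arg_maxnP _ (finset.set0 : {set {ffun 'I_n -> 'I_B}}) (min_distance d)
  (fun C => #|C|) md0) => C mdC maxC.
exists C; split=> //.
have cover : ([set: {ffun 'I_n -> 'I_B}] \subset
    \bigcup_(x in C) [set y | hamming x y < d])%SET.
  apply/fintype.subsetP => y _; apply/bigcupP; apply: contrapT => nC.
  have far x : x \in C -> d <= hamming x y.
    by move=> xC; rewrite leqNgt; apply/negP => xy; apply: nC; exists x; rewrite ?inE.
  have yC : y \notin C.
    apply/negP => /far; rewrite leqNgt => /negP; apply.
    rewrite /hamming /diff_set (_ : finset _ = finset.set0) ?cards0 //.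
    by apply/setP => k; rewrite !inE eqxx.
  suff /maxC : min_distance d (y |: C)%SET by rewrite /= cardsU1 yC add1n ltnn.
  apply/forall_inP => x; rewrite !inE => /orP[/eqP ->|xC];
    apply/forall_inP => z; rewrite !inE => /orP[/eqP ->|zC]; apply/implyP => xz.
  - by rewrite eqxx in xz.
  - by rewrite hammingC; exact: far.
  - exact: far.
  - by move/forall_inP: mdC => /(_ _ xC)/forall_inP/(_ _ zC)/implyP; apply.
have := subset_leq_card cover; rewrite cardsT card_ffun !card_ord => /leq_trans; apply.
apply: (leq_trans (card_bigcup_le _ _)).
rewrite -sum_nat_const; apply: leq_sum => x _; exact: hamming_ball_card.
Qed.
End Hamming.

(** * Nested levels of digits on spheres *)

Lemma pigeonhole_fiber (T : finType) (A : {set T}) (M : nat) (h : T -> 'I_M.+1) :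
  exists m, (#|A| <= #|[set x in A | h x == m]%SET| * M.+1)%N.
Proof.
case: (@arg_maxnP _ (ord0 : 'I_M.+1) predT
  (fun m => #|[set x in A | h x == m]%SET|)) => // m _ maxm.
exists m; rewrite -sum1_card (partition_big h predT) //=.
rewrite mulnC -[X in (_ <= X * _)%N]card_ord -sum_nat_const.
apply: leq_sum => j _; apply: leq_trans (maxm j isT).
by rewrite sum1_card; apply: subset_leq_card; apply/fintype.subsetP => x; rewrite !inE.
Qed.

(** The reason for the base [2 * Q]: fine digits below [Q] fill only half of each coarse
    interval. *)
Lemma digit_gap (Q x y s s' : nat) :
  (x < y)%N -> (s < Q)%N -> (Q + (2 * Q * x + s) <= 2 * Q * y + s')%N.
Proof. by move=> xy sQ; have := leq_mul (leqnn (2 * Q)) xy; lia. Qed.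

Section Levels.
Variables (R : realType) (n : nat).

(** [f i] is a codeword before scaling into [[a, b]], and the [w i l] are the weights of its tests.
    Integer digits give the squared norms a finite range, as the pigeonhole principle requires. *)
Definition separating (I T : finType) (Q : nat) (tau : R)
    (f : T -> 'I_n -> nat) (w : T -> I -> 'I_n -> R) : Prop :=
  [/\ forall i k, (f i k < Q)%N,
      forall i l k, `|w i l k| <= 1 &
      forall i j, i != j ->
        exists l, tau <= \sum_k w i l k * ((f i k)%:R - (f j k)%:R)].

(* On a sphere, [<v, v - u> = |v - u|^2 / 2], so that the single test with weights proportional
   to [v] rejects every [u] which is far from [v]; words in the same galaxy
   (same coarse digits [x]) have the same differences as their fine digits. *)
Lemma separating_step (I T : finType) (Q B d : nat) (tau : R)
    (C : {set {ffun 'I_n -> 'I_B}}) (f : T -> 'I_n -> nat) (w : T -> I -> 'I_n -> R) :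
  (0 < Q)%N -> (0 < B)%N -> min_distance d C -> tau <= d%:R * Q%:R / (4 * B%:R) ->
  separating Q tau f w ->
  exists (T' : finType) (f' : T' -> 'I_n -> nat) (w' : T' -> option I -> 'I_n -> R),
    separating (2 * Q * B) tau f' w' /\
    (#|T| * #|C| <= #|T'| * (n * (2 * Q * B) ^ 2).+1)%N.
Proof.
move=> Q_gt0 B_gt0 /forall_inP mdC tau_le [fQ w_le1 sep].
pose g (p : T * {ffun 'I_n -> 'I_B}) k := (2 * Q * p.2 k + f p.1 k)%N.
have g_lt p k : (g p k < 2 * Q * B)%N.
  have := fQ p.1 k; have := ltn_ord (p.2 k); rewrite /g; nia.
pose sqnorm p := (\sum_k g p k ^ 2)%N.
have sqnorm_lt p : (sqnorm p < (n * (2 * Q * B) ^ 2).+1)%N.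
  rewrite ltnS -[X in (_ <= X * _)%N]card_ord -sum_nat_const.
  by apply: leq_sum => k _; rewrite leq_exp2r // ltnW.
have [m le_m] :=
  pigeonhole_fiber (finset.setX (finset.setTfor T) C) (fun p => Ordinal (sqnorm_lt p)).
set F := finset _ in le_m.
(* The words of [F] share the squared norm [m]. Tests [Some l] come from the fine digits; [None] is
   the new test, with weights scaled into [[0, 1]]. *)
exists {p | p \in F}.
exists (fun p => g (sval p)).
exists (fun p l k => if l is Some l then w (sval p).1 l k
                     else (g (sval p) k)%:R / (2 * Q * B)%:R).
split; last first.
  by rewrite card_sig -cardsT -cardsX.
have K_gt0 : 0 < (2 * Q * B)%:R :> R by rewrite ltr0n; lia.
split=> [p k|p [l|] k|]; [exact: g_lt|exact: w_le1| |].
  by rewrite ger0_norm ?divr_ge0 // ler_pdivrMr // mul1r ler_nat ltnW.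
case=> p pF [q qF] /=.
rewrite -(inj_eq val_inj) /= => pq.
have [pC pm] : p.2 \in C /\ sqnorm p = m.
  by move: pF; rewrite !inE => /andP[? /eqP <-].
have [qC qm] : q.2 \in C /\ sqnorm q = m.
  by move: qF; rewrite !inE => /andP[? /eqP <-].
have [pq2|pq2] := eqVneq p.2 q.2.
  have pq1 : p.1 != q.1.
    by apply: contra pq => /eqP; case: (p) (q) pq2 => ? ? [? ?] /= -> ->.
  have [l le_l] := sep _ _ pq1; exists (Some l); apply: (le_trans le_l).
  apply: ler_sum => k _; rewrite /g pq2 !natrD.
  by rewrite le_eqVlt; apply/orP; left; apply/eqP; congr (_ * _); ring.
exists None.
have normR r : \sum_k ((g r k)%:R ^+ 2 : R) = (sqnorm r)%:R.
  by rewrite natr_sum; apply: eq_bigr => k _; rewrite natrX.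
have -> : \sum_k ((g p k)%:R / (2 * Q * B)%:R) * ((g p k)%:R - (g q k)%:R) =
    (\sum_k ((g p k)%:R - (g q k)%:R : R) ^+ 2) / (2 * (2 * Q * B)%:R).
  transitivity ((\sum_k (((g p k)%:R - (g q k)%:R : R) ^+ 2 + ((g p k)%:R ^+ 2 - (g q k)%:R ^+ 2)))
      / (2 * (2 * Q * B)%:R)).
    rewrite mulr_suml; apply: eq_bigr => k _.
    move: (_%:R : R) K_gt0 => K K_gt0; field.
    exact: lt0r_neq0.
  by rewrite big_split /= sumrB !normR pm qm subrr addr0.
apply: (le_trans tau_le); rewrite ler_pdivlMr ?mulr_gt0 //.
have -> : d%:R * Q%:R / (4 * B%:R) * (2 * (2 * Q * B)%:R) = (d%:R * Q%:R ^+ 2 : R).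
  rewrite !natrM; field; rewrite pnatr_eq0; lia.
have := mdC _ pC => /forall_inP /(_ _ qC) /implyP /(_ pq2) dpq.
apply: (@le_trans _ _ (\sum_(k in diff_set p.2 q.2) Q%:R ^+ 2)).
  by rewrite sumr_const -[leRHS]mulr_natl ler_wpM2r ?sqr_ge0 // ler_nat.
rewrite big_mkcond; apply: ler_sum => k _; case: ifPn => [|_]; last exact: sqr_ge0.
rewrite inE => pqk.
rewrite -[leRHS]real_normK ?num_real // ler_pXn2r ?nnegrE //.
have fp := fQ p.1 k; have fq := fQ q.1 k.
rewrite /g ler_normr; case: (ltngtP (p.2 k) (q.2 k)) pqk => [lt _|lt _|/val_inj ->].
- by apply/orP; right; rewrite opprB lerBrDr -natrD ler_nat digit_gap.
- by apply/orP; left; rewrite lerBrDr -natrD ler_nat digit_gap.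
- by rewrite eqxx.
Qed.

(** Induction from a single word without tests. Each level adds one test and multiplies the size by
    [#|C|] over the number of norms, which is bounded throughout by its value at level [L]. The gap
    condition is tightest at the first level, where the scale is 1. *)
Lemma separating_levels (L B d : nat) (tau : R) :
  (0 < B)%N -> (0 < d)%N -> tau <= d%:R / (4 * B%:R) ->
  forall i, (i <= L)%N ->
  exists (I T : finType) (f : T -> 'I_n -> nat) (w : T -> I -> 'I_n -> R),
    [/\ #|I| = i, separating ((2 * B) ^ i) tau f w &
    (B ^ (n * i) <= #|T| * (2 ^ n * B ^ d * (n * ((2 * B) ^ L) ^ 2).+1) ^ i)%N].
Proof.
move=> B_gt0 d_gt0 tau_le.
have [C [mdC cardC]] := gilbert_varshamov n B_gt0 d_gt0.
elim=> [_|i IH iL].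
  exists void, unit, (fun _ _ => 0%N), (fun _ (l : void) => match l with end).
  by split; [rewrite card_void|split=> // -[] []|rewrite muln0 !expn0 card_unit].
have [I [T [f [w [cI sep cT]]]]] := IH (ltnW iL).
have Qi : (0 < (2 * B) ^ i)%N by rewrite expn_gt0; lia.
have tau_le' : tau <= d%:R * ((2 * B) ^ i)%:R / (4 * B%:R).
  apply: (le_trans tau_le); rewrite ler_wpM2r ?invr_ge0 ?mulr_ge0 //.
  by rewrite ler_peMr // ler1n.
have [T' [f' [w' [sep' cT']]]] := separating_step Qi B_gt0 mdC tau_le' sep.
exists (option I), T', f', w'; split; first by rewrite card_option cI.
  by rewrite expnS -mulnA [(B * _)%N]mulnC mulnA.
have : ((n * (2 * (2 * B) ^ i * B) ^ 2).+1 <= (n * ((2 * B) ^ L) ^ 2).+1)%N.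
  rewrite ltnS leq_mul2l leq_exp2r //; apply/orP; right.
  rewrite -mulnA [(_ * B)%N]mulnC mulnA -expnS leq_pexp2l //; lia.
move: ((n * (2 * (2 * B) ^ i * B) ^ 2).+1) ((n * ((2 * B) ^ L) ^ 2).+1) cT' cT => M1 M cT' cT M1M.
rewrite mulnS expnD expnS.
apply: (leq_trans (leq_mul cardC cT)).
set V := (2 ^ n * B ^ d)%N in cardC *.
have -> : (#|C| * V * (#|T| * (V * M) ^ i) = (#|T| * #|C|) * (V * (V * M) ^ i))%N by ring.
apply: (leq_trans (leq_mul (leq_trans cT' _) (leqnn _))).
  by apply: leq_mul (leqnn _) M1M.
by rewrite leq_eqVlt; apply/orP; left; apply/eqP; ring.
Qed.
End Levels.

(** * From separating families to identification codes *)

Section Achievability.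
Variables (R : realType) (a b : R) (a_ge0 : 0 <= a) (ltab : a < b) (b_le1 : b <= 1).
Let B := restricted_bernoulli a_ge0 b_le1.

(** [D j] consists of the outputs that no test of [j] rejects. The threshold is half of the
    separation, so the first error is a union bound over the tests, and the second is one tail of
    the test separating [j] from [i]. *)
Lemma DI_code_of_separating n (I T : finType) (Q : nat) (t : R)
    (f : T -> 'I_n -> nat) (w : T -> I -> 'I_n -> R) :
  (0 < n)%N -> (0 < Q)%N -> 0 <= t <= 2 * Num.sqrt n%:R ->
  separating Q (2 * t * Num.sqrt n%:R * Q%:R / (b - a)) f w ->
  exists (u : 'I_#|T| -> {ffun 'I_n -> bernoulli_input a b})
    (D : 'I_#|T| -> {set {ffun 'I_n -> bool}}),
    is_DI_code B (#|I|%:R * expR (- (t ^+ 2 / 8))) (expR (- (t ^+ 2 / 8))) u D.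
Proof.
move=> n_gt0 Q_gt0 t_bnd [fQ w_le1 sep].
have Q_gt0' : 0 < Q%:R :> R by rewrite ltr0n.
have ba_gt0 : 0 < b - a by rewrite subr_gt0.
pose x p k : R := a + (b - a) / Q%:R * (f p k)%:R.
have x_ab p k : a <= x p k <= b.
  rewrite /x lerDl mulr_ge0 ?divr_ge0 ?(ltW ba_gt0) //= -lerBrDl.
  rewrite mulrAC ler_pdivrMr // ler_wpM2l ?(ltW ba_gt0) // ler_nat ltnW //.
pose u (i : 'I_#|T|) : {ffun 'I_n -> bernoulli_input a b} :=
  [ffun k => exist _ (x (enum_val i) k) (x_ab (enum_val i) k)].
have uE i k : sval (u i k) = x (enum_val i) k by rewrite ffunE.
(* The minus sign makes rejection an upper tail: sending a word separated from [i] pulls the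
   statistic with weights [w] down. *)
pose reject i l : {set {ffun 'I_n -> bool}} := [set y : {ffun 'I_n -> bool} |
  t * Num.sqrt n%:R <= \sum_k - w (enum_val i) l k * ((y k)%:R - sval (u i k))]%SET.
exists u, (fun i => ~: \bigcup_l reject i l)%SET => i j ij; split.
  rewrite memoryless_setC lerD2l lerN2; apply: memoryless_bigcup_le => l.
  by apply: bernoulli_tail => // k; rewrite normrN.
have [l sep_l] : exists l, 2 * t * Num.sqrt n%:R * Q%:R / (b - a) <=
    \sum_k w (enum_val j) l k * ((f (enum_val j) k)%:R - (f (enum_val i) k)%:R).
  by apply: sep; rewrite (inj_eq enum_val_inj) eq_sym.
have gap : 2 * t * Num.sqrt n%:R <=
    \sum_k w (enum_val j) l k * (sval (u j k) - sval (u i k)).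
  have -> : \sum_k w (enum_val j) l k * (sval (u j k) - sval (u i k)) = (b - a) / Q%:R *
      \sum_k w (enum_val j) l k * ((f (enum_val j) k)%:R - (f (enum_val i) k)%:R).
    by rewrite mulr_sumr; apply: eq_bigr => k _; rewrite !uE /x; ring.
  by rewrite [leRHS]mulrC -ler_pdivrMr ?divr_gt0 // invf_div mulrA.
apply: le_trans (bernoulli_tail a_ge0 b_le1 (u i) (w := w (enum_val j) l) n_gt0 _ t_bnd) => //.
apply: memoryless_subset; apply/fintype.subsetP => y; rewrite !inE => /bigcupP accept.
have {}accept : \sum_k - w (enum_val j) l k * ((y k)%:R - sval (u j k)) < t * Num.sqrt n%:R.
  by rewrite ltNge; apply/negP => rej; apply: accept; exists l; rewrite ?inE.
rewrite (eq_bigr (fun k => - (- w (enum_val j) l k * ((y k)%:R - sval (u j k))) +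
    w (enum_val j) l k * (sval (u j k) - sval (u i k)))); last by move=> k _; ring.
by rewrite big_split /= sumrN; lra.
Qed.
End Achievability.

(** * The converse: Bhattacharyya coefficients *)

Lemma prod_1B_ge (R : realType) (I : finType) (c : I -> R) :
  (forall i, 0 <= c i <= 1) -> 1 - \sum_i c i <= \prod_i (1 - c i).
Proof.
move=> c01.
(* The bounds are carried along because the induction step [(1 - c) y >= y - c] uses [y <= 1]. *)
suff : (0 <= \prod_i (1 - c i) <= 1) && (1 - \sum_i c i <= \prod_i (1 - c i)).
  by case/andP.
elim/big_rec2: _ => [|i x y _ /andP[/andP[y0 y1] xy]]; first by rewrite subr0 ler01 !lexx.
have /andP[c0 c1] := c01 i; apply/andP; split; [apply/andP; split; nra|nra].
Qed.

Lemma sqrtr_prod (R : rcfType) (I : finType) (F : I -> R) : (forall i, 0 <= F i) ->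
  Num.sqrt (\prod_i F i) = \prod_i Num.sqrt (F i).
Proof.
move=> F0; elim/big_rec2: _ => [|i x y _ <-]; first by rewrite sqrtr1.
by rewrite sqrtrM.
Qed.

Section Bhattacharyya.
Variables (R : realType) (X : Type) (Y : finType) (W : channel R X Y) (n : nat).

(* Splitting the sum over [D] and its complement, with weighted AM-GM on each part:
   [sqrt (p q) <= (p / 4 + 4 q) / 2] on [D] and [sqrt (p q) <= (4 p + q / 4) / 2] off [D]. *)
Lemma bhattacharyya_le (x x' : {ffun 'I_n -> X}) (D : {set {ffun 'I_n -> Y}}) (l1 l2 : R) :
  1 - l1 <= memoryless W x D -> memoryless W x' D <= l2 ->
  \prod_(k < n) \sum_(c : Y) Num.sqrt (W (x k) c) * Num.sqrt (W (x' k) c)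
  <= 1 / 4 + 2 * (l1 + l2).
Proof.
move=> xD x'D.
have pE (z z' : {ffun 'I_n -> X}) y : Num.sqrt (word_prob W z y) =
    \prod_(k < n) Num.sqrt (W (z k) (y k)).
  by rewrite /word_prob sqrtr_prod // => k; exact: transition_ge0.
have amgm (s p q : R) : 0 < s -> 0 <= p -> 0 <= q ->
    Num.sqrt p * Num.sqrt q <= (s * p + q / s) / 2.
  move=> s0 p0 q0; rewrite -{2}(sqr_sqrtr p0) -{2}(sqr_sqrtr q0).
  move: (Num.sqrt p) (Num.sqrt q) => u v; rewrite -subr_ge0.
  have -> : (s * u ^+ 2 + v ^+ 2 / s) / 2 - u * v = (s * u - v) ^+ 2 / (2 * s).
    by field; rewrite gt_eqF.
  by rewrite divr_ge0 ?sqr_ge0 // mulr_ge0 // ltW.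
rewrite bigA_distr_bigA /=.
apply: (@le_trans _ _ (\sum_y Num.sqrt (word_prob W x y) * Num.sqrt (word_prob W x' y))).
  by rewrite le_eqVlt; apply/orP; left; apply/eqP/eq_bigr => y _; rewrite !pE // big_split.
rewrite (bigID (mem D)) /=.
have in_D : \sum_(y in D) Num.sqrt (word_prob W x y) * Num.sqrt (word_prob W x' y)
    <= (1 / 4 * memoryless W x D + memoryless W x' D / (1 / 4)) / 2.
  rewrite /memoryless mulr_sumr !mulr_suml -big_split mulr_suml /=.
  by apply: ler_sum => y _; apply: amgm; rewrite ?word_prob_ge0 //; lra.
have out_D : \sum_(y | y \notin D) Num.sqrt (word_prob W x y) * Num.sqrt (word_prob W x' y)
    <= (4 * memoryless W x (~: D)%SET + memoryless W x' (~: D)%SET / 4) / 2.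
  rewrite /memoryless mulr_sumr !mulr_suml -big_split mulr_suml /=.
  rewrite [leRHS](eq_bigl (fun y => y \notin D)); last by move=> y; rewrite inE.
  by apply: ler_sum => y _; apply: amgm; rewrite ?word_prob_ge0 //; lra.
(* The two parts are at most [1 / 8 + 2 * l2] and [1 / 8 + 2 * l1]. *)
apply: (le_trans (lerD in_D out_D)); rewrite !memoryless_setC.
have := memoryless_subset W x (finset.subsetT D).
have := memoryless_subset W x' (finset.subsetT D).
have := memoryless_setC W x finset.set0; rewrite finset.setC0 /memoryless big_set0 => ->.
have := memoryless_setC W x' finset.set0; rewrite finset.setC0 /memoryless big_set0 => ->.
rewrite -!/(memoryless _ _ _) => ? ?.
have : 0 <= memoryless W x' D by apply: sumr_ge0 => y _; exact: word_prob_ge0.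
lra.
Qed.
End Bhattacharyya.

Section Converse.
Variables (R : realType) (a b : R) (a_ge0 : 0 <= a) (b_le1 : b <= 1).
Let B := restricted_bernoulli a_ge0 b_le1.

Definition amplitude_gap (x : R) : R := Num.sqrt x - Num.sqrt (1 - x).

(* [amplitude_gap] is increasing, so that its increment is the sum of those of [sqrt x] and
   [- sqrt (1 - x)]. *)
Lemma bernoulli_affinity_ge (x x' : bernoulli_input a b) :
  1 - (amplitude_gap (sval x) - amplitude_gap (sval x')) ^+ 2 / 2 <=
  \sum_(c : bool) Num.sqrt (B x c) * Num.sqrt (B x' c).
Proof.
rewrite big_bool /= /bernoulli_transition /bernoulli_pmf /= /amplitude_gap.
case/andP: (svalP x) => ax xb; case/andP: (svalP x') => ax' xb'.
move: (sval x) (sval x') ax xb ax' xb' => {}x {}x' ax xb ax' xb'.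
have x0 : 0 <= x := le_trans a_ge0 ax.
have x1 : 0 <= 1 - x by rewrite subr_ge0 (le_trans xb b_le1).
have x'0 : 0 <= x' := le_trans a_ge0 ax'.
have x'1 : 0 <= 1 - x' by rewrite subr_ge0 (le_trans xb' b_le1).
have := sqr_sqrtr x0; have := sqr_sqrtr x1; have := sqr_sqrtr x'0; have := sqr_sqrtr x'1.
(* One minus the affinity is half the sum of the squared increments of [sqrt x] and [sqrt (1 - x)];
   adding [cross] completes it to half the squared increment of [amplitude_gap]. *)
have cross : 0 <= (Num.sqrt x - Num.sqrt x') * (Num.sqrt (1 - x') - Num.sqrt (1 - x)).
  have [xx'|/ltW xx'] := leP x x'.
    by apply: mulr_le0; rewrite subr_le0 ler_wsqrtr //; lra.
  by apply: mulr_ge0; rewrite subr_ge0 ler_wsqrtr //; lra.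
move: cross; move: (Num.sqrt x) (Num.sqrt x') (Num.sqrt (1 - x)) (Num.sqrt (1 - x')).
move=> p q r s; nra.
Qed.

(** The shift by 1 makes the argument nonnegative on [[0, 1]], where [truncn] is the floor. *)
Definition cell_index (K : nat) (x : R) : nat := Num.truncn ((amplitude_gap x + 1) * K%:R).

Lemma amplitude_gap_bound (x : R) : 0 <= x <= 1 -> 0 <= amplitude_gap x + 1 <= 2.
Proof.
move=> /andP[x0 x1]; rewrite /amplitude_gap.
have := sqrtr_ge0 x; have := sqrtr_ge0 (1 - x).
have : Num.sqrt x <= 1 by rewrite -[leRHS]sqrtr1 ler_wsqrtr.
have : Num.sqrt (1 - x) <= 1 by rewrite -[leRHS]sqrtr1 ler_wsqrtr //; lra.
move=> ? ? ? ?; apply/andP; split; lra.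
Qed.

Lemma same_cell (K : nat) (x x' : R) : (0 < K)%N -> 0 <= x <= 1 -> 0 <= x' <= 1 ->
  cell_index K x = cell_index K x' -> (amplitude_gap x - amplitude_gap x') ^+ 2 <= K%:R ^- 2.
Proof.
move=> K0 /amplitude_gap_bound /andP[hx _] /amplitude_gap_bound /andP[hx' _].
have K0' : 0 < K%:R :> R by rewrite ltr0n.
rewrite /cell_index => eq.
have := truncn_itv (mulr_ge0 hx (ltW K0')); have := truncn_itv (mulr_ge0 hx' (ltW K0')).
rewrite eq -natr1; move: ((Num.truncn ((amplitude_gap x' + 1) * K%:R))%:R : R).
move: (amplitude_gap x) (amplitude_gap x') => z z' m /andP[h1 h2] /andP[h3 h4].
rewrite -[leRHS]mul1r ler_pdivlMr ?exprn_gt0 // -exprMn.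
by rewrite -real_normK ?num_real // exprn_ile1 // ler_norml; apply/andP; split; lra.
Qed.

(** Two codewords in the same cells have Bhattacharyya coefficient at least
    [1 - n / (2 K^2) >= 1 / 2], while the code conditions force it below [1 / 4 + 2 / 8]. Hence the
    map to cells is injective. *)
Lemma DI_code_card_le n N K (l1 l2 : R) (u : 'I_N -> {ffun 'I_n -> bernoulli_input a b})
    (D : 'I_N -> {set {ffun 'I_n -> bool}}) :
  (0 < K)%N -> (n <= K ^ 2)%N -> l1 + l2 < 1 / 8 ->
  is_DI_code B l1 l2 u D -> (N <= (2 * K).+1 ^ n)%N.
Proof.
move=> K_gt0 nK l_lt code.
have u01 i k : 0 <= sval (u i k) <= 1.
  case/andP: (svalP (u i k)) => au ub.
  by rewrite (le_trans a_ge0 au) (le_trans ub b_le1).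
pose phi i := [ffun k => inord (cell_index K (sval (u i k))) : 'I_(2 * K).+1].
have cell_le i k : (cell_index K (sval (u i k)) < (2 * K).+1)%N.
  have /andP[_ le2] := amplitude_gap_bound (u01 i k).
  rewrite ltnS truncn_le_nat -natr1 natrM (@le_lt_trans _ _ (2 * K%:R)) ?ltrDl //.
  by rewrite ler_wpM2r.
suff phi_inj : injective phi.
  by have := leq_card phi phi_inj; rewrite card_ffun !card_ord.
move=> i j phi_ij; have [//|ij] := eqVneq i j; exfalso.
have [ui _] := code i j ij.
have [|_ uj] := code j i; first by rewrite eq_sym.
have := bhattacharyya_le ui uj; apply/negP; rewrite -ltNge.
have K_gt0' : 0 < K%:R :> R by rewrite ltr0n.
have cell k : cell_index K (sval (u i k)) = cell_index K (sval (u j k)).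
  by have /ffunP/(_ k) := phi_ij; rewrite !ffunE => /(congr1 val); rewrite /= !inordK.
pose c k := (amplitude_gap (sval (u i k)) - amplitude_gap (sval (u j k))) ^+ 2 / 2.
have c_le k : c k <= K%:R ^- 2 / 2 by rewrite ler_wpM2r ?invr_ge0 // same_cell.
have Kinv_le1 : K%:R ^- 2 <= 1 :> R by rewrite invf_le1 ?exprn_gt0 // exprn_ege1 // ler1n.
have c01 k : 0 <= c k <= 1.
  by rewrite divr_ge0 ?sqr_ge0 //=; have := c_le k; lra.
apply: (@lt_le_trans _ _ (1 - \sum_k c k)).
  have : \sum_k c k <= n%:R * (K%:R ^- 2 / 2).
    rewrite -[X in X%:R]card_ord -sum1_card natr_sum mulr_suml.
    by apply: ler_sum => k _; rewrite mul1r.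
  have : n%:R * K%:R ^- 2 <= 1 :> R.
    by rewrite ler_pdivrMr ?exprn_gt0 // mul1r -natrX ler_nat.
  lra.
apply: (le_trans (prod_1B_ge c01)); apply: ler_prod => k _.
by rewrite bernoulli_affinity_ge andbT subr_ge0; case/andP: (c01 k).
Qed.
End Converse.

(** * Rates *)

Section Rate.
Variables (R : realType) (a b : R) (a_ge0 : 0 <= a) (b_le1 : b <= 1).
Let B := restricted_bernoulli a_ge0 b_le1.

Definition DI_error (n : nat) : R := 2 * expR (- 2 * (log2 (n%:R : R)) ^+ 2).

Lemma ln_ge_near (A : R) : \forall n \near \oo, A <= ln (n%:R : R).
Proof.
near=> n; have : expR A <= n%:R by near: n; exact: nbhs_infty_ger.
move=> h; rewrite -[A]expRK ler_ln ?posrE ?expR_gt0 //.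
exact: lt_le_trans (expR_gt0 _) h.
Unshelve. all: by end_near. Qed.

Lemma ln2_gt0 : 0 < ln 2 :> R.
Proof. by rewrite ln_gt0 // ltr1n. Qed.

Lemma log2_ge_near (A : R) : \forall n \near \oo, A <= log2 (n%:R : R).
Proof.
near=> n; rewrite /log2 ler_pdivlMr ?ln2_gt0 //.
by near: n; exact: ln_ge_near.
Unshelve. all: by end_near. Qed.

(** Cube of [1 + z / 3 <= expR (z / 3)]; the degree 3 is what outgrows the squared logarithm in
    [log2_sqr_near]. *)
Lemma expR_ge_cube (z : R) : 0 <= z -> z ^+ 3 / 27 <= expR z.
Proof.
move=> z0; have -> : z = 3%:R * (z / 3) by field.
rewrite expRM_natl.
have -> : (3%:R * (z / 3)) ^+ 3 / 27 = (z / 3) ^+ 3 by field.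
rewrite ler_pXn2r ?nnegrE ?expR_ge0 ?divr_ge0 //.
by apply: le_trans (expR_ge1Dx _); rewrite lerDr.
Qed.

Lemma log2_sqr_near (c : R) (m : nat) : (0 < m)%N ->
  \forall n \near \oo, c * log2 (n%:R : R) ^+ 2 <= expR (ln n%:R / m%:R).
Proof.
move=> m0; have m0' : 0 < m%:R :> R by rewrite ltr0n.
near=> n.
have y0 : 0 <= ln (n%:R : R) by near: n; exact: ln_ge_near.
have yc : 27 * m%:R ^+ 3 * c / ln 2 ^+ 2 <= ln (n%:R : R) by near: n; exact: ln_ge_near.
apply: le_trans (expR_ge_cube (divr_ge0 y0 (ltW m0'))).
rewrite /log2; move: (ln n%:R) y0 yc => y y0 yc.
have -> : c * (y / ln 2) ^+ 2 = (27 * m%:R ^+ 3 * c / ln 2 ^+ 2) * y ^+ 2 / m%:R ^+ 3 / 27.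
  by field; rewrite !gt_eqF ?ln2_gt0.
have -> : (y / m%:R) ^+ 3 / 27 = y * y ^+ 2 / m%:R ^+ 3 / 27 by field; rewrite gt_eqF.
rewrite ler_wpM2r // ler_wpM2r ?invr_ge0 ?exprn_ge0 ?(ltW m0') //.
by rewrite ler_wpM2r ?sqr_ge0.
Unshelve. all: by end_near. Qed.

Lemma is_DI_codeW (n N : nat) (l1 l2 m1 m2 : R) (u : 'I_N -> {ffun 'I_n -> bernoulli_input a b})
    (D : 'I_N -> {set {ffun 'I_n -> bool}}) :
  l1 <= m1 -> l2 <= m2 -> is_DI_code B l1 l2 u D -> is_DI_code B m1 m2 u D.
Proof.
move=> le1 le2 code i j ij; have [h1 h2] := code i j ij.
by split; [apply: le_trans h1; rewrite lerD2l lerN2|exact: le_trans le2].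
Qed.

Lemma ln_DI_code_card_le n N (l1 l2 : R) (u : 'I_N -> {ffun 'I_n -> bernoulli_input a b})
    (D : 'I_N -> {set {ffun 'I_n -> bool}}) :
  (0 < n)%N -> l1 + l2 < 1 / 8 -> is_DI_code B l1 l2 u D ->
  ln (N%:R : R) <= n%:R * ln n%:R / 2 + ln 5 * n%:R.
Proof.
move=> n_gt0 l_lt code.
have n_gt0' : 0 < n%:R :> R by rewrite ltr0n.
have n_ge1 : 1 <= n%:R :> R by rewrite ler1n.
have [->|N_gt0] := posnP N.
  rewrite ln0 // addr_ge0 ?mulr_ge0 ?divr_ge0 ?ln_ge0 // ?ler1n //.
have rn_ge1 : 1 <= Num.sqrt n%:R :> R by rewrite -[leLHS]sqrtr1 ler_wsqrtr.
pose K := (Num.truncn (Num.sqrt n%:R : R)).+1.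
have K_gt : Num.sqrt n%:R < K%:R :> R by exact: truncnS_gt.
have K_le : K%:R <= Num.sqrt n%:R + 1 :> R.
  by rewrite -natr1 lerD2r; case/andP: (truncn_itv (sqrtr_ge0 (n%:R : R))).
have nK : (n <= K ^ 2)%N.
  rewrite -(ler_nat R) natrX -[leLHS]sqr_sqrtr //.
  by rewrite ler_pXn2r ?nnegrE ?sqrtr_ge0 // ltW.
have := DI_code_card_le (ltn0Sn _ : (0 < K)%N) nK l_lt code.
rewrite -(ler_nat R) natrX => N_le.
(* [2 * K + 1 <= 2 * sqrt n + 3], and [sqrt n >= 1]. *)
have M_le : (2 * K).+1%:R <= 5 * Num.sqrt n%:R :> R by rewrite -natr1 natrM; lra.
have r_gt0 : 0 < 5 * Num.sqrt n%:R :> R by lra.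
have : ln (N%:R : R) <= ln ((5 * Num.sqrt n%:R) ^+ n).
  rewrite ler_ln ?posrE ?ltr0n ?exprn_gt0 //; apply: (le_trans N_le).
  by rewrite lerXn2r ?nnegrE // ltW.
move=> /le_trans; apply; rewrite lnXn // lnM ?posrE ?sqrtr_gt0 //.
have -> : ln (n%:R : R) = ln (Num.sqrt n%:R) *+ 2.
  by rewrite -lnXn ?sqrtr_gt0 // sqr_sqrtr.
by rewrite -mulr_natl -mulr_natr le_eqVlt; apply/orP; left; apply/eqP; field.
Qed.

(** With [t = 8 * log2 n] the exponent is [8 (log2 n)^2]; the surplus [6 (log2 n)^2] over that of
    [DI_error] absorbs the factor [L] of the union bound. *)
Lemma error_exponent_le (L n : nat) : (0 < L)%N -> L%:R <= log2 (n%:R : R) ->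
  L%:R * expR (- ((8 * log2 n%:R) ^+ 2 / 8)) <= DI_error n.
Proof.
move=> L_gt0; rewrite /DI_error; move: (log2 _) => l Ll.
have L1 : 1 <= L%:R :> R by rewrite ler1n.
have -> : - ((8 * l) ^+ 2 / 8) = - 2 * l ^+ 2 + - (6 * l ^+ 2) by field.
rewrite expRD mulrCA mulrC ler_wpM2r ?expR_ge0 // expRN.
rewrite ler_pdivrMr ?expR_gt0 //.
have := expR_ge1Dx (6 * l ^+ 2); nra.
Qed.

(** The digit size [q] is the floor of [n^(1/(2L+3))]: the separation condition costs [q^(2(L+1))],
    and one spare factor [q] pays for constants and logarithms. *)
Lemma DI_code_exists (L n : nat) :
  a < b -> (0 < L)%N -> (2 * L.+1 <= n)%N -> L%:R <= log2 (n%:R : R) ->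
  16 * log2 (n%:R : R) ^+ 2 <= n%:R ->
  2 * (128 * L.+1%:R * 2 ^+ L / (b - a)) ^+ 2 * log2 (n%:R : R) ^+ 2
    <= expR (ln n%:R / (2 * L + 3)%:R) ->
  exists N (u : 'I_N -> {ffun 'I_n -> bernoulli_input a b})
     (D : 'I_N -> {set {ffun 'I_n -> bool}}),
    is_DI_code B (DI_error n) (DI_error n) u D /\
    L%:R ^+ 2 / (L.+1%:R * (2 * L + 3)%:R) * (n%:R * ln n%:R)
      - (L%:R * (L%:R / L.+1%:R * ln 2 + ln 2 + ln (2 * 4 ^+ L : R) + 2)) * n%:R
    <= ln (N%:R : R).
Proof.
set m := (2 * L + 3)%N; set l := log2 _; set E := expR _ => ltab L_gt0 nL lL l16 lE.
have ba_gt0 : 0 < b - a by rewrite subr_gt0.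
have L1 : 1 <= L%:R :> R by rewrite ler1n.
have l_ge0 : 0 <= l by lra.
have n_gt0 : (0 < n)%N by exact: leq_trans nL.
have n_gt0' : 0 < n%:R :> R by rewrite ltr0n.
have n_ge1 : 1 <= n%:R :> R by rewrite ler1n.
have m_gt0 : 0 < m%:R :> R by rewrite ltr0n /m addn3.
have y_ge0 : 0 <= ln (n%:R : R) by rewrite ln_ge0.
have E_ge1 : 1 <= E by rewrite -expR0 ler_expR divr_ge0 ?(ltW m_gt0).
pose q := Num.truncn E.
have /andP[qE Eq] : q%:R <= E < q.+1%:R by apply: truncn_itv; lra.
have q_gt0 : (0 < q)%N by rewrite truncn_gt0.
have q_gt0' : 0 < q%:R :> R by rewrite ltr0n.
have q1 : 1 <= q%:R :> R by rewrite ler1n.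
have E2q : E <= 2 * q%:R by move: Eq; rewrite -natr1; lra.
have Em : E ^+ m = n%:R.
  by rewrite -expRM_natl mulrCA mulfV ?gt_eqF // mulr1 lnK.
have qm : q%:R ^+ m <= n%:R :> R by rewrite -Em lerXn2r ?nnegrE ?(ltW q_gt0') //; lra.
pose d := (n %/ L.+1)%N.
have dn : (d * L.+1 <= n)%N by exact: leq_trunc_div.
have d_gt0 : (0 < d)%N by rewrite divn_gt0 //; apply: leq_trans nL; rewrite leq_pmull.
have nd : (n <= 2 * L.+1 * d)%N.
  apply: (leq_trans (ltnW (ltn_ceil n (ltn0Sn L)))).
  by rewrite -/d mulnAC leq_mul2r /= mul2n -addnn -addn1 leq_add2l.
pose t := 8 * l.
have rn_gt0 : 0 < Num.sqrt n%:R :> R by rewrite sqrtr_gt0.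
have rn2 : Num.sqrt n%:R ^+ 2 = n%:R :> R by rewrite sqr_sqrtr // ltW.
have t_bnd : 0 <= t <= 2 * Num.sqrt n%:R.
  rewrite /t; apply/andP; split; first lra.
  have : (4 * l) ^+ 2 <= Num.sqrt n%:R ^+ 2 by rewrite rn2; lra.
  by rewrite ler_pXn2r ?nnegrE ?sqrtr_ge0 //; lra.
pose Q := ((2 * q) ^ L)%N.
have Q_gt0 : (0 < Q)%N by rewrite expn_gt0 muln_gt0 q_gt0.
(* [128 = 2 * 2 * 8 * 4] collects the factors of [n <= 2 (L + 1) d], of the doubled threshold, of
   [t = 8 l] and of [4 q]; [2 ^ L] comes from [Q]. *)
pose K := 128 * L.+1%:R * 2 ^+ L / (b - a).
have K_gt0 : 0 < K by rewrite divr_gt0 ?mulr_gt0 ?exprn_gt0 ?ltr0n.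
have Kl : K * l * q%:R ^+ L.+1 <= Num.sqrt n%:R.
  have : (K * l * q%:R ^+ L.+1) ^+ 2 <= Num.sqrt n%:R ^+ 2.
    rewrite rn2 (_ : (K * l * q%:R ^+ L.+1) ^+ 2 = K ^+ 2 * l ^+ 2 * q%:R ^+ (L.+1 * 2));
      last by rewrite exprM; ring.
    apply: (le_trans _ qm); have -> : m = (1 + L.+1 * 2)%N by rewrite /m; clear; lia.
    rewrite (_ : q%:R ^+ (1 + L.+1 * 2) = q%:R * q%:R ^+ (L.+1 * 2)); last by rewrite exprD.
    apply: ler_wpM2r; first by rewrite exprn_ge0.
    by move: lE; rewrite -/K; lra.
  have Kl_ge0 : 0 <= K * l * q%:R ^+ L.+1.
    by apply: mulr_ge0; [exact: mulr_ge0 (ltW K_gt0) l_ge0|rewrite exprn_ge0].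
  by rewrite ler_pXn2r // nnegrE // ltW.
have tau_le : 2 * t * Num.sqrt n%:R * Q%:R / (b - a) <= d%:R / (4 * q%:R).
  rewrite ler_pdivlMr ?mulr_gt0 //.
  have L2_gt0 : 0 < 2 * L.+1%:R :> R by rewrite mulr_gt0 ?ltr0n.
  have nd' : n%:R <= 2 * L.+1%:R * d%:R :> R by rewrite -!natrM ler_nat.
  rewrite -(ler_pM2l L2_gt0); apply: (le_trans _ nd').
  have -> : 2 * L.+1%:R * (2 * t * Num.sqrt n%:R * Q%:R / (b - a) * (4 * q%:R)) =
      Num.sqrt n%:R * (K * l * q%:R ^+ L.+1).
    rewrite /t /K /Q natrX !natrM exprMn [q%:R ^+ L.+1]exprS; field.
    by rewrite gt_eqF.
  by rewrite -[leRHS]rn2 expr2 ler_wpM2l // ltW.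
have [I [T [f [w [cardI sep cardT]]]]] :=
  @separating_levels R n L q d _ q_gt0 d_gt0 tau_le L (leqnn L).
have [u [D code]] := DI_code_of_separating a_ge0 ltab b_le1 n_gt0 Q_gt0 t_bnd sep.
exists #|T|, u, D; split.
  apply: is_DI_codeW code; first by rewrite cardI; exact: error_exponent_le.
  apply: (le_trans _ (error_exponent_le L_gt0 lL)).
  by rewrite ler_peMl ?expR_ge0.
have T_gt0 : (0 < #|T|)%N.
  rewrite lt0n; apply/eqP => T0; move: cardT.
  by rewrite T0 mul0n leqn0 expn_eq0 => /andP[/eqP q0]; rewrite q0 in q_gt0.
set M := (n * Q ^ 2).+1 in cardT.
have M_gt0 : (0 < M)%N by [].
(* The number of norms is polynomial in [n], so its logarithm fits into the linear term. *)
have lnM_le : ln (M%:R : R) <= (ln (2 * 4 ^+ L) + 2) * n%:R.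
  have M_le : M%:R <= 2 * 4 ^+ L * n%:R ^+ 2 :> R.
    have Q2 : Q%:R ^+ 2 <= 4 ^+ L * n%:R :> R.
      rewrite /Q natrX natrM exprMn exprMn -exprM -exprM mulnC exprM.
      have -> : 2 ^+ 2 = 4 :> R by ring.
      rewrite ler_wpM2l ?exprn_ge0 //; apply: (le_trans _ qm).
      by rewrite mulnC ler_weXn2l // /m; clear; lia.
    have : 1 <= 4 ^+ L * n%:R ^+ 2 :> R.
      by rewrite -[X in X <= _]mulr1 ler_pM ?exprn_ege1 // ler1n.
    rewrite /M -[(_ * _).+1]addn1 natrD natrM natrX.
    have : n%:R * Q%:R ^+ 2 <= n%:R * (4 ^+ L * n%:R) :> R by rewrite ler_wpM2l // ltW.
    lra.
  have c_gt0 : 0 < 2 * 4 ^+ L :> R by rewrite mulr_gt0 ?exprn_gt0.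
  apply: (@le_trans _ _ (ln (2 * 4 ^+ L * n%:R ^+ 2))).
    by rewrite ler_ln ?posrE ?mulr_gt0 ?exprn_gt0.
  rewrite lnM ?posrE ?exprn_gt0 // lnXn // [leRHS]mulrDl.
  have : ln n%:R <= n%:R :> R.
    have := @le_ln1Dx R (n%:R - 1).
    rewrite (_ : 1 + (n%:R - 1) = n%:R); last by ring.
    by move=> h; have {}h := h _; lra.
  have : 0 <= ln (2 * 4 ^+ L : R).
    by rewrite ln_ge0 // -[X in X <= _]mulr1 ler_pM ?exprn_ege1 // ler1n.
  rewrite [ln n%:R *+ 2]mulr2n => c_ge0; have := ler_peMr c_ge0 n_ge1. lra.
have := cardT; rewrite -(ler_nat R) natrX natrM natrX !natrM 2!natrX => cardT'.
have V_gt0 : 0 < 2 ^+ n * q%:R ^+ d * M%:R :> R by rewrite !mulr_gt0 ?exprn_gt0 ?ltr0n.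
(* Since [d <= n / (L + 1)], the main term [L (n - d) ln q] is at least [n ln q L^2 / (L + 1)];
   rounding costs at most [ln 2] in [ln q]. *)
have : ln (q%:R ^+ (n * L) : R) <= ln (#|T|%:R * (2 ^+ n * q%:R ^+ d * M%:R) ^+ L).
  by rewrite ler_ln ?posrE ?mulr_gt0 ?exprn_gt0 ?ltr0n.
rewrite lnXn // lnM ?posrE ?exprn_gt0 ?ltr0n //.
rewrite lnXn // lnM ?posrE ?mulr_gt0 ?exprn_gt0 ?ltr0n //.
rewrite lnM ?posrE ?exprn_gt0 // !lnXn //.
rewrite -[ln _ *+ (n * L)]mulr_natl -[ln 2 *+ n]mulr_natl -[ln _ *+ d]mulr_natl.
rewrite -[_ *+ L]mulr_natl natrM.
have lnq : ln n%:R / m%:R - ln 2 <= ln q%:R :> R.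
  rewrite lerBlDl -lnM ?posrE // -[leLHS]expRK ler_ln ?posrE ?expR_gt0 ?mulr_gt0 //.
have lnq_ge0 : 0 <= ln q%:R :> R by rewrite ln_ge0.
have dn' : d%:R <= n%:R / L.+1%:R :> R.
  by rewrite ler_pdivlMr ?ltr0n // -natrM ler_nat.
move: lnM_le lnq lnq_ge0 dn'; set x := ln #|T|%:R; set y := ln n%:R; set z := ln q%:R.
set v := ln M%:R; set c := ln (2 * 4 ^+ L); set l2 := ln 2.
move=> lnM_le lnq lnq_ge0 dn' cnt.
have S_gt0 : 0 < L.+1%:R :> R by rewrite ltr0n.
have h1 : d%:R * z <= n%:R / L.+1%:R * z by rewrite ler_wpM2r.
have h2 : L%:R * (n%:R * l2 + d%:R * z + v) <=
    L%:R * (n%:R * l2 + n%:R / L.+1%:R * z + (c + 2) * n%:R).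
  by apply: ler_wpM2l => //; apply: lerD lnM_le; rewrite lerD2l.
have h3 : L%:R * (n%:R * L%:R / L.+1%:R) * (y / m%:R - l2) <= L%:R * (n%:R * L%:R / L.+1%:R) * z.
  by rewrite ler_wpM2l // mulr_ge0 ?divr_ge0 ?mulr_ge0 // ltW.
have h4 : n%:R * L%:R * z - L%:R * (n%:R / L.+1%:R * z) = L%:R * (n%:R * L%:R / L.+1%:R) * z.
  by rewrite -natr1; field; rewrite natr1 gt_eqF.
have -> : L%:R ^+ 2 / (L.+1%:R * m%:R) * (n%:R * y) -
     L%:R * (L%:R / L.+1%:R * l2 + l2 + c + 2) * n%:R =
   L%:R * (n%:R * L%:R / L.+1%:R) * (y / m%:R - l2) - L%:R * (n%:R * l2 + (c + 2) * n%:R).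
  by field; rewrite !gt_eqF.
rewrite -h4 in h3; move: h2 h3 cnt {h1 h4}.
move: (n%:R / L.+1%:R * z) (L%:R * (n%:R * L%:R / L.+1%:R) * (y / m%:R - l2)) => k p h2 h3 cnt.
clear -h2 h3 cnt.
lra.
Qed.
End Rate.

(** * Limits of the linearithmic ratio and of the errors *)

Section Limits.
Variable R : realType.

Lemma linearithmic_ratioE (N : nat -> nat) n :
  linearithmic_ratio R N n = ln (N n)%:R / (n%:R * ln n%:R).
Proof.
by rewrite /linearithmic_ratio /log2 mulrA invf_div mulrA divfK // gt_eqF ?ln2_gt0.
Qed.

Lemma linearithmic_ratio_le (N : nat -> nat) (C e : R) : 0 < e ->
  (\forall n \near \oo, ln (N n)%:R <= n%:R * ln n%:R / 2 + C * n%:R) ->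
  \forall n \near \oo, linearithmic_ratio R N n <= 1 / 2 + e.
Proof.
move=> e_gt0 leN; near=> n.
have n_gt0 : 0 < n%:R :> R by rewrite ltr0n; near: n; exact: nbhs_infty_gt.
have y1 : 1 <= ln n%:R :> R by near: n; exact: ln_ge_near.
have yC : C / e <= ln n%:R :> R by near: n; exact: ln_ge_near.
have leNn : ln (N n)%:R <= n%:R * ln n%:R / 2 + C * n%:R by near: n.
rewrite linearithmic_ratioE ler_pdivrMr ?mulr_gt0 //; last by lra.
apply: (le_trans leNn); move: yC; rewrite ler_pdivrMr // => yC.
have := ler_wpM2l (ltW n_gt0) yC; lra.
Unshelve. all: by end_near. Qed.

(** Half of [e] pays for the defect of the [L]-level rate, the other half for [C / ln n]. As [L] is
    fixed before [n], the constant [C] may depend on it. *)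
Lemma linearithmic_ratio_ge (N : nat -> nat) (e : R) : 0 < e ->
  (forall L, (0 < L)%N -> exists C : R, \forall n \near \oo,
     L%:R ^+ 2 / (L.+1%:R * (2 * L + 3)%:R) * (n%:R * ln n%:R) - C * n%:R <= ln (N n)%:R) ->
  \forall n \near \oo, 1 / 2 - e <= linearithmic_ratio R N n.
Proof.
move=> e_gt0 geN.
have [L L_gt0 Le] : exists2 L, (0 < L)%N & 4 / e < L%:R.
  by exists (Num.truncn (4 / e)).+1 => //; exact: truncnS_gt.
have [C geN_L] := geN L L_gt0.
near=> n.
have n_gt0 : 0 < n%:R :> R by rewrite ltr0n; near: n; exact: nbhs_infty_gt.
have y1 : 1 <= ln n%:R :> R by near: n; exact: ln_ge_near.
have yC : 2 * C / e <= ln n%:R :> R by near: n; exact: ln_ge_near.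
have : L%:R ^+ 2 / (L.+1%:R * (2 * L + 3)%:R) * (n%:R * ln n%:R) - C * n%:R <= ln (N n)%:R.
  by near: n.
rewrite linearithmic_ratioE ler_pdivlMr ?mulr_gt0 //; last by lra.
apply: le_trans.
have {}yC : C <= e / 2 * ln n%:R.
  by move: yC; rewrite ler_pdivrMr //; lra.
(* The defect is [(5 L + 3) / (2 (L + 1) (2 L + 3))], below [e / 2] once [e L > 4]. *)
have rate_ge : 1 / 2 - e / 2 <= L%:R ^+ 2 / (L.+1%:R * (2 * L + 3)%:R) :> R.
  have L_ge1 : 1 <= L%:R :> R by rewrite ler1n.
  move: Le; rewrite ltr_pdivrMr // -(natr1 L) [(2 * L + 3)%:R]natrD [(2 * L)%:R]natrM => Le.
  have D_gt0 : 0 < (L%:R + 1) * (2 * L%:R + 3) :> R by apply: mulr_gt0; lra.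
  rewrite ler_pdivlMr //; move: (L%:R : R) Le L_ge1 {D_gt0} => x Le x1; nra.
have ny_ge0 : 0 <= n%:R * ln n%:R :> R by rewrite mulr_ge0 //; lra.
have h1 := ler_wpM2r ny_ge0 rate_ge.
have h2 := ler_wpM2r (ltW n_gt0) yC.
move: h1 h2; move: (_ / _ * _) => p; lra.
Unshelve. all: by end_near. Qed.

Lemma DI_error_near_le (e : R) : 0 < e -> \forall n \near \oo, DI_error R n <= e.
Proof.
move=> e_gt0; near=> n; rewrite /DI_error mulNr expRN.
have l1 : 1 <= log2 n%:R :> R by near: n; exact: log2_ge_near.
have le1 : 1 / e <= log2 n%:R :> R by near: n; exact: log2_ge_near.
rewrite ler_pdivrMr ?expR_gt0 //.
move: (log2 _) l1 le1 => l l1; rewrite ler_pdivrMr // => le1.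
have h := ler_wpM2l (ltW e_gt0) (expR_ge1Dx (2 * l ^+ 2)).
apply: (le_trans _ h).
have : l <= l ^+ 2 by rewrite expr2 ler_peMl //; lra.
move/(ler_wpM2l (ltW e_gt0)); lra.
Unshelve. all: by end_near. Qed.

Lemma DI_error_cvg0 : @DI_error R @ \oo --> (0 : R).
Proof.
apply/cvgrPdist_le => e e_gt0; near=> n.
rewrite sub0r normrN ger0_norm; last by rewrite mulr_ge0 ?expR_ge0.
by near: n; exact: DI_error_near_le.
Unshelve. all: by end_near. Qed.
End Limits.

(** * Codes of maximal size and the capacity *)

Section Capacity.
Variables (R : realType) (a b : R) (a_ge0 : 0 <= a) (b_le1 : b <= 1).
Let B := restricted_bernoulli a_ge0 b_le1.

Definition code_exists n N (l : R) : Prop :=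
  exists (u : 'I_N -> {ffun 'I_n -> bernoulli_input a b})
     (D : 'I_N -> {set {ffun 'I_n -> bool}}), is_DI_code B l l u D.

Lemma near_optimal_sizes :
  exists N : nat -> nat, (forall n, code_exists n (N n) (DI_error R n)) /\
    (forall n M, (0 < n)%N -> DI_error R n + DI_error R n < 1 / 8 ->
      code_exists n M (DI_error R n) -> (M <= N n)%N).
Proof.
have /choice [N HN] : forall n, exists N, code_exists n N (DI_error R n) /\
    ((0 < n)%N -> DI_error R n + DI_error R n < 1 / 8 ->
      forall M, code_exists n M (DI_error R n) -> (M <= N)%N).
  move=> n.
  (* The cap makes a maximum exist for every [n], even where the errors are too large for the
     converse; elsewhere the converse with [K = n + 1] shows that it excludes no code. Size 0
     satisfies [P] vacuously. *)
  pose P M := (M <= (2 * n.+1).+1 ^ n)%N && `[< code_exists n M (DI_error R n) >].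
  have P0 : exists M, P M.
    have F : 'I_0 -> False by case.
    exists 0%N; apply/andP; split=> //; apply/asboolP.
    by exists (fun i => False_rect _ (F i)), (fun i => False_rect _ (F i)) => i; case: (F i).
  have Pbound M : P M -> (M <= (2 * n.+1).+1 ^ n)%N by case/andP.
  case: (ex_maxnP P0 Pbound) => N /andP[_ /asboolP PN] maxN.
  exists N; split=> // n_gt0 l_lt M codeM; apply: maxN; apply/andP; split; last exact/asboolP.
  have [u [D code]] := codeM.
  by apply: (@DI_code_card_le _ _ _ a_ge0 b_le1 n M n.+1 _ _ u D _ _ l_lt code) => //; nia.
by exists N; split=> [n|n M n_gt0 l_lt]; [case: (HN n)|case: (HN n) => _; apply].
Qed.

Lemma achievable_sizes (N : nat -> nat) : a < b ->
  (forall n M, (0 < n)%N -> DI_error R n + DI_error R n < 1 / 8 ->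
      code_exists n M (DI_error R n) -> (M <= N n)%N) ->
  forall L, (0 < L)%N -> exists C : R, \forall n \near \oo,
     L%:R ^+ 2 / (L.+1%:R * (2 * L + 3)%:R) * (n%:R * ln n%:R) - C * n%:R <= ln (N n)%:R.
Proof.
(* [C] is found by unification with the linear term of [DI_code_exists], which depends on [L] but
   not on [n]. *)
move=> ltab maxN L L_gt0; eexists; near=> n.
have n_gt0 : (0 < n)%N by near: n; exact: nbhs_infty_gt.
have [||||M [u [D [code leM]]]] := @DI_code_exists R a b a_ge0 b_le1 L n ltab L_gt0.
- by near: n; exact: nbhs_infty_ge.
- by near: n; exact: log2_ge_near.
- near: n; have := @log2_sqr_near R 16 1 isT; apply: filterS2 (nbhs_infty_gt 0) => n n0.
  by rewrite divr1 lnK // posrE ltr0n.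
- by near: n; apply: log2_sqr_near; rewrite addn3.
apply: (le_trans leM).
have [->|M_gt0] := posnP M.
  by rewrite ln0 //; case: (posnP (N n)) => [->|N_gt0]; [rewrite ln0|rewrite ln_ge0 // ler1n].
have MN : (M <= N n)%N.
  apply: maxN => //; last by exists u, D.
  (* Any bound below [1 / 16] brings the sum of the two errors under [1 / 8]. *)
  have : DI_error R n <= 1 / 17 by near: n; apply: DI_error_near_le.
  lra.
by rewrite ler_ln ?posrE ?ltr0n ?ler_nat // (leq_trans M_gt0).
Unshelve. all: by end_near. Qed.

(** The errors vanish, so their sum is eventually below [1 / 8] and the size bound applies; its
    linear term is negligible against [n ln n]. *)
Lemma achievable_rate_le_half (rate : R) :
  achievable_linearithmic_rate B rate -> rate <= 1 / 2.
Proof.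
case=> _ [N [l1 [l2 [u [D [code l1_0 l2_0 ratio]]]]]].
apply/ler_addgt0Pr => e e_gt0.
rewrite -(cvg_lim _ ratio) //; apply: limr_le; first by apply/cvg_ex; exists rate.
apply: (@linearithmic_ratio_le _ _ (ln 5)) => //.
have := (cvgrPdist_le _ _).1 l1_0 (1 / 32); have := (cvgrPdist_le _ _).1 l2_0 (1 / 32).
move=> /(_ _) small2 /(_ _) small1; near=> n.
have n_gt0 : (0 < n)%N by near: n; exact: nbhs_infty_gt.
apply: ln_DI_code_card_le (code n n_gt0) => //.
have : `|0 - l1 n| <= 1 / 32 by near: n; apply: small1; lra.
have : `|0 - l2 n| <= 1 / 32 by near: n; apply: small2; lra.
by rewrite !ler_norml; lra.
Unshelve. all: by end_near. Qed.
End Capacity.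


Theorem theorem10 (R : realType) (a b : R)
    (a_ge0 : 0 <= a) (ltab : a < b) (b_le1 : b <= 1)
    (L : nat) (L_ge1 : (1 <= L)%N) :
  let B := restricted_bernoulli a_ge0 b_le1 in
  let lambda := fun n : nat => 2 * expR (- 2 * (log2 (n%:R : R)) ^+ 2) in
  (exists (N : nat -> nat)
      (u : forall n, 'I_(N n) -> {ffun 'I_n -> bernoulli_input a b})
      (D : forall n, 'I_(N n) -> {set {ffun 'I_n -> bool}}),
    (\forall n \near \oo,
       is_DI_code B (L%:R * lambda n) (lambda n) (u n) (D n)) /\
    linearithmic_ratio R N @ \oo --> (1 / 2 : R)) /\
  is_linearithmic_DI_capacity B (1 / 2).
Proof.
move=> B lambda.
have [N [codeN maxN]] := near_optimal_sizes a_ge0 b_le1.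
pose u n := projT1 (cid (codeN n)).
have codeu n : exists D, is_DI_code B (lambda n) (lambda n) (u n) D := projT2 (cid (codeN n)).
pose D n := projT1 (cid (codeu n)).
have code n : is_DI_code B (lambda n) (lambda n) (u n) (D n) := projT2 (cid (codeu n)).
have ratio : linearithmic_ratio R N @ \oo --> (1 / 2 : R).
  apply/cvgrPdist_le => e e_gt0; near=> n.
  have : linearithmic_ratio R N n <= 1 / 2 + e.
    near: n; apply: (@linearithmic_ratio_le _ _ (ln 5)) => //; near=> n.
    apply: ln_DI_code_card_le (code n); first by near: n; exact: nbhs_infty_gt.
    have : lambda n <= 1 / 17 by near: n; apply: DI_error_near_le.
    lra.
  have : 1 / 2 - e <= linearithmic_ratio R N n.
    near: n; apply: linearithmic_ratio_ge => //.
    exact: (achievable_sizes ltab maxN).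
  by rewrite ler_norml; lra.
split.
  (* The maximal codes are the same for every [L]; their first error [lambda n] is at most
     [L * lambda n]. *)
  exists N, u, D; split=> //; apply: nearW => n.
  apply: is_DI_codeW (code n) => //.
  by rewrite ler_peMl ?mulr_ge0 ?expR_ge0 // ler1n.
split; last exact: achievable_rate_le_half.
split; first by [].
by exists N, lambda, lambda, u, D; split;
  [move=> n _; exact: code|exact: DI_error_cvg0|exact: DI_error_cvg0|exact: ratio].
Unshelve. all: by end_near. Qed.
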